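(* Let $t\in\mathbb{R}$ and $h\in\mathbb{H}_t$. The operator $M_h$ is an isometry in $\mathcal{M}_t$ (i.e. $M_h^{*}M_h=1_t$) if and only if it is unitary in $\mathcal{M}_t$ (i.e. $M_h^{*}M_h=1_t=M_hM_h^{*}$).
   Context: For $t\in\mathbb{R}$, the $t$-scaled hypercomplex ring $\mathbb{H}_t$ is the set $\mathbb{C}^2$ with the usual vector addition and the multiplication $(a_1,b_1)\cdot_t(a_2,b_2)=(a_1a_2+t\,b_1\overline{b_2},\;a_1b_2+b_1\overline{a_2})$, regarded also as a vector space over $\mathbb{R}$; $(a,b)^{\dagger}=(\overline{a},-b)$. For $\eta\in\mathbb{H}_t$, $M_\eta:\mathbb{H}_t\to\mathbb{H}_t$ is the $\mathbb{R}$-linear multiplication operator $M_\eta(h)=\eta\cdot_t h$. The hypercomplex algebra over $\mathbb{R}$ is $\mathcal{M}_t=\{M_\eta:\eta\in\mathbb{H}_t\}$, with operator addition and composition, with adjoint $M_\eta^{*}=M_{\eta^{\dagger}}$ and identity $1_t=M_{(1,0)}$. *)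

(* Defs.v *)
From HB Require Import structures.
From mathcomp Require Import all_boot all_order all_algebra all_field.
From mathcomp Require Import classical_sets reals.
From mathcomp Require Import complex ring.

Set Implicit Arguments.
Unset Strict Implicit.
Unset Printing Implicit Defensive.

Import GRing.Theory.

Local Open Scope ring_scope.
Local Open Scope complex_scope.

(* A record rather than the pair type [R[i] * R[i]], which already carries the
   componentwise product. The parameter [t] does not occur in the carrier; it
   selects the multiplication. *)
Record hyper (R : realType) (t : R) : Type := Hyper { hfst : R[i]; hsnd : R[i] }.
Arguments Hyper {R} t _ _.

Section Hypercomplex.
Variables (R : realType) (t : R).
Implicit Types x y z : hyper t.

Let C2_of_hyper x : R[i] * R[i] := (hfst x, hsnd x).
Let hyper_of_C2 (u : R[i] * R[i]) : hyper t := Hyper t u.1 u.2.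
Let hyperK : cancel C2_of_hyper hyper_of_C2. Proof. by case. Qed.

HB.instance Definition _ := Choice.copy (hyper t) (can_type hyperK).

Definition hzero : hyper t := Hyper t 0 0.

Definition hopp x : hyper t := Hyper t (- hfst x) (- hsnd x).

Definition hadd x y : hyper t := Hyper t (hfst x + hfst y) (hsnd x + hsnd y).

Definition hscale (k : R) x : hyper t := Hyper t (k%:C * hfst x) (k%:C * hsnd x).

Definition hone : hyper t := Hyper t 1 0.

Definition hmul x y : hyper t :=
  Hyper t (hfst x * hfst y + t%:C * hsnd x * (hsnd y)^*)
          (hfst x * hsnd y + hsnd x * (hfst y)^*).

Definition hdag x : hyper t := Hyper t (hfst x)^* (- hsnd x).


Lemma haddA : associative hadd.
Proof. by move=> x y z; rewrite /hadd /= !addrA. Qed.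

Lemma haddC : commutative hadd.
Proof. by move=> x y; rewrite /hadd; congr (Hyper _ _ _); rewrite addrC. Qed.

Lemma hadd0 : left_id hzero hadd.
Proof. by case=> a b; rewrite /hadd /= !add0r. Qed.

Lemma haddN : left_inverse hzero hopp hadd.
Proof. by move=> x; rewrite /hadd /= !addNr. Qed.

HB.instance Definition _ :=
  GRing.isZmodule.Build (hyper t) haddA haddC hadd0 haddN.

Lemma hscaleA (k l : R) x : hscale k (hscale l x) = hscale (k * l) x.
Proof. by rewrite /hscale /= !rmorphM !mulrA. Qed.

Lemma hscale1 : left_id 1 hscale.
Proof. by case=> a b; rewrite /hscale !mul1r. Qed.

Lemma hscaleDr : right_distributive hscale +%R.
Proof. by move=> k x y; congr (Hyper _ _ _); rewrite mulrDr. Qed.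

Lemma hscaleDl x : {morph hscale^~ x : k l / k + l}.
Proof. by move=> k l; congr (Hyper _ _ _); rewrite rmorphD mulrDl. Qed.

HB.instance Definition _ := GRing.Zmodule_isLmodule.Build R (hyper t)
  hscaleA hscale1 hscaleDr hscaleDl.

Let hyperP (a b c d a' b' c' d' : R) :
  a = a' -> b = b' -> c = c' -> d = d' ->
  Hyper t (a +i* b) (c +i* d) = Hyper t (a' +i* b') (c' +i* d').
Proof. by move=> -> -> -> ->. Qed.

Lemma hmulA : associative hmul.
Proof.
by move=> [[a1 a2] [b1 b2]] [[c1 c2] [d1 d2]] [[e1 e2] [f1 f2]];
  apply: hyperP; ring.
Qed.

Lemma hmul1l : left_id hone hmul.
Proof. by move=> [[a1 a2] [b1 b2]]; apply: hyperP; ring. Qed.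

Lemma hmul1r : right_id hone hmul.
Proof. by move=> [[a1 a2] [b1 b2]]; apply: hyperP; ring. Qed.

Lemma hmulDl : left_distributive hmul +%R.
Proof.
by move=> [[a1 a2] [b1 b2]] [[c1 c2] [d1 d2]] [[e1 e2] [f1 f2]];
  apply: hyperP; ring.
Qed.

Lemma hmulDr : right_distributive hmul +%R.
Proof.
by move=> [[a1 a2] [b1 b2]] [[c1 c2] [d1 d2]] [[e1 e2] [f1 f2]];
  apply: hyperP; ring.
Qed.

Lemma hone_neq0 : hone != 0.
Proof. by apply/eqP => -[/eqP]; rewrite oner_eq0. Qed.

HB.instance Definition _ := GRing.Zmodule_isNzRing.Build (hyper t)
  hmulA hmul1l hmul1r hmulDl hmulDr hone_neq0.

Lemma hscalerAl (k : R) x y : k *: (x * y) = (k *: x) * y.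
Proof.
by case: x y => [[a1 a2] [b1 b2]] [[c1 c2] [d1 d2]]; apply: hyperP; ring.
Qed.

HB.instance Definition _ := GRing.Lmodule_isLalgebra.Build R (hyper t) hscalerAl.

Lemma hscalerAr (k : R) x y : k *: (x * y) = x * (k *: y).
Proof.
by case: x y => [[a1 a2] [b1 b2]] [[c1 c2] [d1 d2]]; apply: hyperP; ring.
Qed.

HB.instance Definition _ := GRing.Lalgebra_isAlgebra.Build R (hyper t) hscalerAr.

Fact hyper_vect_iso : Vector.axiom 4 (hyper t).
Proof.
exists (fun x => \row_(i < 4)
    [:: Re (hfst x); Im (hfst x); Re (hsnd x); Im (hsnd x)]`_i).
  move=> k [[a1 a2] [b1 b2]] [[c1 c2] [d1 d2]]; apply/rowP => i.
  by rewrite !mxE; case: i => -[|[|[|[|//]]]] ? /=; rewrite !mul0r ?subr0 ?addr0.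
exists (fun v : 'rV[R]_4 => Hyper t (v 0 (inord 0) +i* v 0 (inord 1))
                                    (v 0 (inord 2) +i* v 0 (inord 3))).
  by case=> [[a1 a2] [b1 b2]]; rewrite !mxE !inordK.
move=> v; apply/rowP => i; rewrite mxE; case: i => -[|[|[|[|//]]]] ? /=;
  by congr (v _ _); apply/val_inj; rewrite /= inordK.
Qed.

HB.instance Definition _ := Lmodule_hasFinDim.Build R (hyper t) hyper_vect_iso.
HB.instance Definition _ := Algebra_isFalgebra.Build R (hyper t).

Definition mulop (eta : hyper t) : 'End(hyper t) := amull eta.

Lemma mulopE eta x : mulop eta x = hmul eta x.
Proof. exact: lfunE. Qed.

Definition hcalg : set 'End(hyper t) := range mulop.

Definition hcid : 'End(hyper t) := mulop hone.

(* An operator [T] of [hcalg] has the unique symbol [T hone], so [hcadj] is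
   the adjoint [mulop eta |-> mulop (hdag eta)]; see [hcadjE]. *)
Definition hcadj (T : 'End(hyper t)) : 'End(hyper t) := mulop (hdag (T hone)).

Lemma hcadjE eta : hcadj (mulop eta) = mulop (hdag eta).
Proof. by rewrite /hcadj mulopE hmul1r. Qed.

Lemma hcidE : hcid = \1%VF.
Proof. exact: amull1. Qed.

Lemma mulopD eta xi : mulop (eta + xi) = mulop eta + mulop xi.
Proof. exact: linearD. Qed.

Lemma mulopM eta xi : mulop (eta * xi) = (mulop eta \o mulop xi)%VF.
Proof. exact: amullM. Qed.

Definition hc_isometry (T : 'End(hyper t)) : Prop :=
  hcalg T /\ (hcadj T \o T)%VF = hcid.

Definition hc_unitary (T : 'End(hyper t)) : Prop :=
  [/\ hcalg T, (hcadj T \o T)%VF = hcid & hcid = (T \o hcadj T)%VF].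

End Hypercomplex.

(* Main.v *)
Require Import Defs.
From mathcomp Require Import all_boot all_algebra.
From mathcomp Require Import complex ring.
From mathcomp Require Import reals.

Import GRing.Theory.
Local Open Scope ring_scope.

(** An isometry in this algebra is unitary because every multiplication operator
    is normal. For [h = (a, b)] both [h^dag * h] and [h * h^dag] are the real
    scalar [|a|^2 - t |b|^2], so [h] commutes with [h^dag] ([hmul_dagC]). As
    [M_] is multiplicative, [M_h] commutes with its adjoint ([mulop_normal]), and
    the two equations defining a unitary are the same equation. *)

(** The second component of [hdag h * h] is [a^* b - b a^*], that of
    [h * hdag h] is [- a b + b a]: both vanish because [R[i]] is commutative. *)
Lemma hmul_dagC (R : realType) (t : R) (h : hyper t) :
  hdag h * h = h * hdag h.
Proof.
(* Real coordinates make conjugation a sign change, visible to [ring]. *)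
by case: h => [[a1 a2] [b1 b2]]; congr (Hyper _ (_ +i* _) (_ +i* _))%C; ring.
Qed.

Lemma mulop_normal (R : realType) (t : R) (h : hyper t) :
  (hcadj (mulop h) \o mulop h)%VF = (mulop h \o hcadj (mulop h))%VF.
Proof. by rewrite hcadjE -!mulopM hmul_dagC. Qed.

Theorem corollary5p8 (R : realType) (t : R) (h : hyper t) :
  hc_isometry (mulop h) <-> hc_unitary (mulop h).
Proof.
split=> [[hM isoM]|[hM isoM _]]; split=> //.
by rewrite -mulop_normal isoM.
Qed.
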